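(* Let $G$ and $H$ be finite simple graphs. If the Cartesian product $G \,\square\, H$ is well-covered, then at least one of $G$ or $H$ is well-covered.
   Context: A graph is well-covered if every maximal independent set of vertices has the same cardinality. The Cartesian product $G\,\square\, H$ has vertex set $V(G)\times V(H)$, with $(x_1,x_2)$ adjacent to $(y_1,y_2)$ if either $x_1=y_1$ and $x_2y_2\in E(H)$, or $x_1y_1\in E(G)$ and $x_2=y_2$. *)

(* Defs.v *)
(* A finite simple graph is a symmetric irreflexive relation
   [e : rel T] on a vertex type [T : finType]. *)
From mathcomp Require Import all_boot.

Set Implicit Arguments.
Unset Strict Implicit.
Unset Printing Implicit Defensive.

Definition independent (T : finType) (e : rel T) (A : {set T}) : bool :=
  [forall x in A, forall y in A, ~~ e x y].

(* Maximal with respect to inclusion, not cardinality. *)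
Definition maximal_independent (T : finType) (e : rel T) (A : {set T}) : bool :=
  maxset (independent e) A.

Definition well_covered (T : finType) (e : rel T) : Prop :=
  forall A B : {set T},
    maximal_independent e A -> maximal_independent e B -> #|A| = #|B|.

Definition cartesian_product (T U : finType) (eG : rel T) (eH : rel U) :
    rel (T * U) :=
  fun x y => ((x.1 == y.1) && eH x.2 y.2) || (eG x.1 y.1 && (x.2 == y.2)).

(* Main.v *)
(* Suppose that G [] H is well-covered but neither G nor H is.  Exchanging one
   fibre of a maximal independent set shows that, in each factor, every vertex
   m of a maximal independent set M has a private neighbour: a vertex outside M
   whose only neighbour in M is m.  Hence a maximal independent set of the
   graph induced outside M is maximal in the whole graph.  If both factors had
   disjoint maximal independent sets of unequal sizes, exchanging I x Q U J x P
   for I x P U J x Q would contradict well-coveredness; so in one factor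
   disjoint maximal independent sets have equal sizes.  In that factor take
   maximal independent I, J with |J| < |I| and |I & J| largest, and F maximal
   independent outside I U J.  Then F completed by J - N(F) has the size of I,
   and F completed by I - N(F) has the size of J, so |F| <= |I & J| and
   |I| <= |F| + |J - I| <= |J|. *)
Require Import Defs.
From mathcomp Require Import all_boot.
From mathcomp Require Import zify.

Set Implicit Arguments.
Unset Strict Implicit.
Unset Printing Implicit Defensive.

(** * Independence and dichotomies on set sizes *)

Lemma independentP (T : finType) (e : rel T) (A : {set T}) :
  reflect {in A &, forall x y, ~~ e x y} (independent e A).
Proof.
apply: (iffP 'forall_in_forall_inP) => [iA x y xA yA | iA x xA y yA].
  exact: iA.
exact: iA.
Qed.

(** A search over the finitely many pairs of sets decides the alternative; symmetry lets an unequal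
    pair be oriented. *)
Lemma unequal_cards_or (T : finType) (P : rel {set T}) : symmetric P ->
  (forall A B, P A B -> #|A| = #|B|) \/
  (exists A B, P A B /\ #|B| < #|A|).
Proof.
move=> P_sym.
case: (pickP [pred p : {set T} * {set T} | P p.1 p.2 && (#|p.2| < #|p.1|)]).
  by move=> [A B] /= /andP[PAB ltBA]; right; exists A, B.
move=> noP; left=> A B PAB; apply/eqP; rewrite eqn_leq.
have:= noP (A, B); have:= noP (B, A).
by rewrite /= (P_sym B) PAB /= !ltnNge => /negbFE-> /negbFE->.
Qed.

Lemma well_covered_or (T : finType) (e : rel T) :
  well_covered e \/
  exists A B, [/\ maximal_independent e A, maximal_independent e B
                & #|B| < #|A|].
Proof.
have sP : symmetric [rel A B | maximal_independent e A && maximal_independent e B].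
  by move=> A B /=; rewrite andbC.
case: (unequal_cards_or sP) => /= [wc | [A [B [/andP[mA mB] ltBA]]]].
  by left=> A B mA mB; apply: wc; rewrite mA.
by right; exists A, B.
Qed.

(** For symmetric irreflexive [e], adjacency of [h] and [m] is implicit: by maximality [h] has a
    neighbour in [M], and it can only be [m]. *)
Definition has_private_neighbors (T : finType) (e : rel T) : Prop :=
  forall (M : {set T}) m, maximal_independent e M -> m \in M ->
  exists2 h, h \notin M & forall m', m' \in M -> e h m' -> m' = m.

Definition disjoint_balanced (T : finType) (e : rel T) : Prop :=
  forall A B : {set T}, maximal_independent e A -> maximal_independent e B ->
  [disjoint A & B] -> #|A| = #|B|.

(** * Maximal independent sets in a single graph *)

Section Graph.
Variables (T : finType) (e : rel T).
Hypotheses (e_sym : symmetric e) (e_irr : irreflexive e).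

Lemma independentU (A B : {set T}) : independent e A -> independent e B ->
  {in A & B, forall x y, ~~ e x y} -> independent e (A :|: B).
Proof.
move=> /independentP iA /independentP iB iAB; apply/independentP => x y.
rewrite !inE => /orP[xA | xB] /orP[yA | yB]; auto.
by rewrite e_sym; auto.
Qed.

Lemma maximal_independentP (A : {set T}) :
  reflect (independent e A /\ forall x, x \notin A -> exists2 y, y \in A & e x y)
          (maximal_independent e A).
Proof.
apply: (iffP maxsetP) => [[iA maxA] | [iA domA]]; split=> //.
  move=> x xA; apply/exists_inP; apply: contraNT xA => /exists_inPn nxA.
  have <- : x |: A = A; last exact: setU11.
  apply: maxA; last exact: subsetUr.
  apply: independentU => // [|u v /set1P-> vA]; last exact: nxA.
  by apply/independentP => u v /set1P-> /set1P->; rewrite e_irr.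
move=> B /independentP iB sAB; apply/eqP; rewrite eqEsubset sAB andbT.
apply/subsetP=> x xB; apply: contraT => /domA[y yA].
by rewrite (negbTE (iB _ _ xB (subsetP sAB _ yA))).
Qed.

Lemma extend_independent (A : {set T}) : independent e A ->
  exists2 B, maximal_independent e B & A \subset B.
Proof. by move=> /maxset_exists[B mB sAB]; exists B. Qed.

Lemma independent_leq (A B : {set T}) : well_covered e ->
  independent e A -> maximal_independent e B -> #|A| <= #|B|.
Proof.
move=> wc /extend_independent[C mC sAC] mB.
by rewrite (wc _ _ mB mC) subset_leq_card.
Qed.

Lemma extend_independent_in (D : {set T}) : exists F : {set T},
  [/\ F \subset D, independent e F
    & forall x, x \in D -> x \notin F -> exists2 y, y \in F & e x y].
Proof.
pose P := [pred F : {set T} | independent e F && (F \subset D)].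
have P0 : P set0.
  by rewrite /= sub0set andbT; apply/independentP => x y; rewrite inE.
have [F /maxsetP[/andP[iF sFD] maxF] _] := maxset_exists P0.
exists F; split=> // x xD xF; apply/exists_inP.
apply: contraNT xF => /exists_inPn nxF.
have <- : x |: F = F; last exact: setU11.
apply: maxF; last exact: subsetUr.
rewrite /= subUset sub1set xD sFD !andbT.
apply: independentU => // [|u v /set1P-> vF]; last exact: nxF.
by apply/independentP => u v /set1P-> /set1P->; rewrite e_irr.
Qed.

(** Adding to [Q] the set [Z] of vertices of [M] with no neighbour in [Q] gives a maximal set. A
    private neighbour of some [z] in [Z] would lie outside [M] and [Q], hence have a second
    neighbour in [Q]; so [Z] is empty. *)
Lemma maximal_outside (M Q : {set T}) :
  has_private_neighbors e -> maximal_independent e M ->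
  independent e Q -> [disjoint M & Q] ->
  (forall x, x \notin M -> x \notin Q -> exists2 y, y \in Q & e x y) ->
  maximal_independent e Q.
Proof.
move=> pn /maximal_independentP[iM domM] iQ dMQ domQ.
pose Z := [set z in M | [forall y in Q, ~~ e z y]].
have mQZ : maximal_independent e (Q :|: Z).
  apply/maximal_independentP; split.
    apply: independentU => //.
      apply/independentP => x y; rewrite !inE => /andP[xM _] /andP[yM _].
      exact: (independentP _ _ iM).
    move=> x y xQ; rewrite inE => /andP[_ /forall_inP nyQ].
    by rewrite e_sym nyQ.
  move=> x; rewrite !inE negb_or => /andP[xQ].
  rewrite negb_and; case: (boolP (x \in M)) => [_ /= | xM _].
    by case/forall_inPn=> y yQ /negPn exy; exists y; rewrite // inE yQ.
  by have [y yQ exy] := domQ x xM xQ; exists y; rewrite // inE yQ.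
have Z0 : Z = set0.
  apply/setP=> z; rewrite in_set0; apply/negbTE/negP => zZ.
  have zQZ : z \in Q :|: Z by rewrite inE zZ orbT.
  have [h hQZ pnh] := pn _ _ mQZ zQZ.
  have zM : z \in M by move: zZ; rewrite inE => /andP[].
  have zQ : z \notin Q by rewrite (disjointFr dMQ).
  have [m mQZ' ehm] : (exists2 m, m \in Q :|: Z & e h m).
    by have /maximal_independentP[_] := mQZ; apply.
  have ehz : e h z by rewrite -(pnh m mQZ' ehm).
  have hM : h \notin M.
    by apply: contraTN ehz => hM; apply: (independentP _ _ iM).
  have hQ : h \notin Q by move: hQZ; rewrite inE negb_or => /andP[].
  have [y yQ ehy] := domQ h hM hQ.
  have yz : y = z by apply: pnh; rewrite // inE yQ.
  by rewrite -yz yQ in zQ.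
by rewrite Z0 setU0 in mQZ.
Qed.

Lemma well_covered_of_disjoint :
  has_private_neighbors e -> disjoint_balanced e -> well_covered e.
Proof.
move=> pn bal.
(* [F'] is disjoint from [I] and dominates all that lies outside [I], so it is maximal by
   [maximal_outside] and has the size of [I] by [bal]. The roles of [I] and [J] are exchanged in a
   second use. *)
have step (I J F : {set T}) :
    maximal_independent e I -> maximal_independent e J ->
    F \subset ~: (I :|: J) -> independent e F ->
    (forall x, x \in ~: (I :|: J) -> x \notin F -> exists2 y, y \in F & e x y) ->
    let F' := F :|: [set z in J :\: I | [forall y in F, ~~ e z y]] in
    maximal_independent e F' /\ #|F'| = #|I|.
  move=> mI mJ sF iF domF F'.
  have dIF : [disjoint I & F'].
    rewrite disjoint_subset; apply/subsetP => x xI; rewrite !inE xI /= orbF.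
    by apply: contraL xI => /(subsetP sF); rewrite !inE negb_or => /andP[].
  have iJ : independent e J by case/maximal_independentP: mJ.
  have mF : maximal_independent e F'.
    apply: (maximal_outside pn mI) => //.
      apply: independentU => //.
        apply/independentP => x y; rewrite !inE => /andP[/andP[_ xJ] _].
        by move=> /andP[/andP[_ yJ] _]; apply: (independentP _ _ iJ).
      move=> x y xF; rewrite inE => /andP[_ /forall_inP nyF].
      by rewrite e_sym nyF.
    move=> x xI; rewrite !inE xI negb_or /= => /andP[xF].
    rewrite negb_and; case: (boolP (x \in J)) => [_ /= | xJ _].
      by case/forall_inPn=> y yF /negPn exy; exists y; rewrite // inE yF.
    have [|y yF exy] := domF x _ xF; first by rewrite !inE negb_or xI.
    by exists y; rewrite // inE yF.
  by split=> //; apply: bal; rewrite // disjoint_sym.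
case: (well_covered_or e) => // -[I [J [mI mJ ltJI]]]; exfalso.
(* Taking the largest intersection becomes induction on the size of its complement. *)
have [n] := ubnP (#|T| - #|I :&: J|).
elim: n => // n IHn in I J mI mJ ltJI *.
rewrite ltnS => le_n.
have [F [sF iF domF]] := extend_independent_in (~: (I :|: J)).
have [mP cP] := step I J F mI mJ sF iF domF.
have [mQ cQ] : let F' := F :|: [set z in I :\: J | [forall y in F, ~~ e z y]] in
    maximal_independent e F' /\ #|F'| = #|J|.
  by apply: step => //; rewrite setUC.
move: mP cP mQ cQ; set P := F :|: _; set Q := F :|: _ => mP cP mQ cQ.
have sFPQ : F \subset P :&: Q by rewrite subsetI !subsetUl.
have leF : #|F| <= #|P :&: Q| by apply: subset_leq_card.
have leP : #|P| <= #|F| + #|J :\: I|.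
  apply: leq_trans (leq_card_setU _ _) _; rewrite leq_add2l.
  by apply: subset_leq_card; apply/subsetP => x; rewrite inE => /andP[].
have cJ := cardsID I J; rewrite setIC in cJ.
(* If [P] and [Q] do not meet in more vertices than [I] and [J], then [#|F| <= #|I :&: J|], whence
   [#|I| = #|P| <= #|J|], which is absurd. Otherwise [P] and [Q] are again of unequal sizes and the
   induction applies. *)
case: (ltnP #|I :&: J| #|P :&: Q|) => ltF; last by lia.
apply: (IHn P Q) => //; first by rewrite cP cQ.
apply: leq_trans le_n; apply: ltn_sub2l => //.
exact: leq_trans ltF (max_card _).
Qed.

End Graph.

(** * Exchange arguments in the Cartesian product *)

Section Product.
Variables (T U : finType) (eG : rel T) (eH : rel U).
Hypotheses (eG_sym : symmetric eG) (eG_irr : irreflexive eG).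
Hypotheses (eH_sym : symmetric eH) (eH_irr : irreflexive eH).
Let eP := cartesian_product eG eH.

Lemma cartesian_product_sym : symmetric eP.
Proof.
move=> x y; rewrite /eP /cartesian_product.
by rewrite (eq_sym x.1) (eq_sym x.2) eG_sym eH_sym.
Qed.

Lemma cartesian_product_irr : irreflexive eP.
Proof. by move=> x; rewrite /eP /cartesian_product eG_irr eH_irr andbF. Qed.

(* Without a private neighbour of [m], the fibre [J] over [m] of a maximal
   independent set containing [I x (M - m)] could be exchanged for [I]. *)
Lemma private_neighbors_of_product (I J : {set T}) :
  well_covered eP -> maximal_independent eG I -> maximal_independent eG J ->
  #|J| < #|I| -> has_private_neighbors eH.
Proof.
move=> wc mI mJ ltJI M m mM mM'.
have /(maximal_independentP eG_sym eG_irr)[/independentP iI _] := mI.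
have /(maximal_independentP eG_sym eG_irr)[/independentP iJ domJ] := mJ.
have /(maximal_independentP eH_sym eH_irr)[/independentP iM _] := mM.
case: (pickP [pred h | (h \notin M) && [forall m' in M, eH h m' ==> (m' == m)]]).
  move=> h /= /andP[hM /forall_inP pnh]; exists h => // m' m'M ehm'.
  by apply/eqP; apply: (implyP (pnh m' m'M)).
move=> nopn; exfalso.
have other h : h \notin M -> exists m', [/\ m' \in M, eH h m' & m' != m].
  move=> hM; have:= nopn h; rewrite /= hM => /negbT/forall_inPn[m' m'M].
  by rewrite negb_imply => /andP[ehm' m'm]; exists m'.
pose S0 := [set x | (x.2 \in M) && (x.1 \in if x.2 == m then J else I)].
have iS0 : independent eP S0.
  apply/independentP => -[g h] [g' h']; rewrite !inE /eP /cartesian_product /=.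
  move=> /andP[hM gh] /andP[h'M gh']; rewrite negb_or !negb_and.
  rewrite (iM h h' hM h'M) orbT /=.
  case: eqP => [hh' | _]; last by rewrite orbT.
  rewrite orbF -hh' in gh' *; case: (h == m) gh gh'; [exact: iJ | exact: iI].
have [S mS /subsetP sS0] := extend_independent iS0.
have /(maximal_independentP cartesian_product_sym cartesian_product_irr)
  [/independentP iS _] := mS.
have sI g h : h \in M -> h != m -> g \in I -> (g, h) \in S.
  by move=> hM /negbTE hm gI; apply: sS0; rewrite inE /= hM hm.
have sJ g : g \in J -> (g, m) \in S.
  by move=> gJ; apply: sS0; rewrite inE /= mM' eqxx.
pose S1 := [set x in S | x.2 != m].
pose S2 := setX I [set m].
have iS12 : independent eP (S1 :|: S2).
  apply: independentU; first exact: cartesian_product_sym.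
  - by apply/independentP => x y; rewrite !inE => /andP[xS _] /andP[yS _]; apply: iS.
  - apply/independentP => -[g h] [g' h']; rewrite !inE /eP /cartesian_product /=.
    move=> /andP[gI /eqP->] /andP[g'I /eqP->].
    by rewrite eH_irr (negbTE (iI _ _ gI g'I)) andbF.
  (* An edge between the two parts forces [g = g'] in [I] and [h] adjacent to [m]. Then [h] has
     another neighbour [m'] in [M], and [(g, m')] in [S] is adjacent to [(g, h)]. *)
  move=> [g h] [g' h']; rewrite !inE /= => /andP[ghS hm] /andP[g'I /eqP->].
  rewrite /eP /cartesian_product /= (negbTE hm) andbF orbF.
  apply/negP => /andP[/eqP gg' ehm].
  have hM : h \notin M by apply: contraTN ehm => hM; apply: iM.
  have [m' [m'M ehm' m'm]] := other h hM.
  have := iS _ _ ghS (sI g' m' m'M m'm g'I).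
  by rewrite /eP /cartesian_product /= gg' eqxx ehm'.
have := independent_leq wc iS12 mS.
have d12 : [disjoint S1 & S2].
  rewrite disjoint_subset; apply/subsetP => x; rewrite !inE => /andP[_ /negbTE->].
  by rewrite andbF.
(* The fibre of [S] over [m] cannot exceed [J], because [J] is already maximal. *)
have sSm : S :\: S1 \subset setX J [set m].
  apply/subsetP => -[g h]; rewrite !inE /= => /andP[+ ghS]; rewrite ghS /= negbK.
  move/eqP=> hm; rewrite hm eqxx andbT in ghS *; apply: contraT => /domJ[g' g'J egg'].
  have := iS _ _ ghS (sJ g' g'J).
  by rewrite /eP /cartesian_product /= egg' eqxx orbT.
have := subset_leq_card sSm; rewrite cardsX cards1 muln1.
have sS1 : S1 \subset S by apply/subsetP => x; rewrite inE => /andP[].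
move: d12; rewrite -leq_card_setU => /eqP->; rewrite cardsX cards1 muln1.
by have := cardsID S1 S; rewrite (setIidPr sS1); lia.
Qed.

(* Trading [I x Q :|: J x P] for the larger [I x P :|: J x Q] inside a maximal
   independent set is legal, as the rest avoids the rows and columns used. *)
Lemma product_disjoint_pairs (I J : {set T}) (P Q : {set U}) :
  well_covered eP -> maximal_independent eG I -> maximal_independent eG J ->
  [disjoint I & J] -> #|J| < #|I| ->
  maximal_independent eH P -> maximal_independent eH Q ->
  [disjoint P & Q] -> #|Q| < #|P| -> False.
Proof.
move=> wc mI mJ dIJ ltJI mP mQ dPQ ltQP.
have /(maximal_independentP eG_sym eG_irr)[/independentP iI domI] := mI.
have /(maximal_independentP eG_sym eG_irr)[/independentP iJ domJ] := mJ.
have /(maximal_independentP eH_sym eH_irr)[/independentP iP domP] := mP.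
have /(maximal_independentP eH_sym eH_irr)[/independentP iQ domQ] := mQ.
have iX (A : {set T}) (B : {set U}) : {in A &, forall x y, ~~ eG x y} ->
    {in B &, forall x y, ~~ eH x y} -> independent eP (setX A B).
  move=> iA iB; apply/independentP => -[g h] [g' h']; rewrite !inE /=.
  move=> /andP[gA hB] /andP[g'A h'B]; rewrite /eP /cartesian_product /=.
  by rewrite (negbTE (iA _ _ gA g'A)) (negbTE (iB _ _ hB h'B)) andbF.
have iXU (A B : {set U}) : [disjoint A & B] -> {in A &, forall x y, ~~ eH x y} ->
    {in B &, forall x y, ~~ eH x y} -> independent eP (setX I A :|: setX J B).
  move=> dAB iA iB; apply: independentU; try exact: iX.
    exact: cartesian_product_sym.
  move=> [g h] [g' h']; rewrite !inE /= => /andP[gI hA] /andP[g'J h'B].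
  rewrite /eP /cartesian_product /=.
  case: eqP => [gg' | _]; first by rewrite -gg' (disjointFr dIJ gI) in g'J.
  case: eqP => [hh' | _]; first by rewrite -hh' (disjointFr dAB hA) in h'B.
  by rewrite andbF.
have cXU (A B : {set U}) : #|setX I A :|: setX J B| = #|I| * #|A| + #|J| * #|B|.
  rewrite -!cardsX; apply/eqP; rewrite leq_card_setU disjoint_subset.
  apply/subsetP => -[g h]; rewrite !inE /= => /andP[gI _].
  by rewrite (disjointFr dIJ gI).
have dQP : [disjoint Q & P] by rewrite disjoint_sym.
pose S0 := setX I Q :|: setX J P.
have [S mS sS0] := extend_independent (iXU _ _ dQP iQ iP).
have /(maximal_independentP cartesian_product_sym cartesian_product_irr)
  [/independentP iS _] := mS.
have sIQ g h : g \in I -> h \in Q -> (g, h) \in S.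
  by move=> gI hQ; apply: (subsetP sS0); rewrite !inE /= gI hQ.
have sJP g h : g \in J -> h \in P -> (g, h) \in S.
  by move=> gJ hP; apply: (subsetP sS0); rewrite !inE /= gJ hP orbT.
have rowS g h h' : (g, h) \in S -> (g, h') \in S -> ~~ eH h h'.
  by move=> x y; have := iS _ _ x y; rewrite /eP /cartesian_product /= eqxx negb_or => /andP[].
have colS g g' h : (g, h) \in S -> (g', h) \in S -> ~~ eG g g'.
  move=> x y; have := iS _ _ x y.
  by rewrite /eP /cartesian_product /= eqxx andbT negb_or => /andP[].
(* If [g] were in [I], then [h] would lie outside [Q] and have a neighbour [h'] there, making
   [(g, h)] and [(g, h')] adjacent in [S]. The other three cases are analogous. *)
have outS g h : (g, h) \in S :\: S0 ->
    [/\ g \notin I, g \notin J, h \notin P & h \notin Q].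
  rewrite !inE /= negb_or !negb_and => /andP[/andP[nIQ nJP] ghS]; split.
  - apply/negP => gI; rewrite gI /= in nIQ; have [h' h'Q] := domQ h nIQ.
    by apply/negP/(rowS g) => //; apply: sIQ.
  - apply/negP => gJ; rewrite gJ /= in nJP; have [h' h'P] := domP h nJP.
    by apply/negP/(rowS g) => //; apply: sJP.
  - apply/negP => hP; rewrite hP orbF in nJP; have [g' g'J] := domJ g nJP.
    by apply/negP/(colS _ _ h) => //; apply: sJP.
  apply/negP => hQ; rewrite hQ orbF in nIQ; have [g' g'I] := domI g nIQ.
  by apply/negP/(colS _ _ h) => //; apply: sIQ.
pose S1 := setX I P :|: setX J Q.
have iS1 : independent eP ((S :\: S0) :|: S1).
  apply: independentU; first exact: cartesian_product_sym.
  - apply/independentP => x y; rewrite inE => /andP[_ xS].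
    by rewrite inE => /andP[_ yS]; apply: iS.
  - exact: iXU.
  move=> [g h] [g' h'] /outS[gI gJ hP hQ]; rewrite !inE /= => g'h'.
  rewrite /eP /cartesian_product /=; case: eqP => [gg' | _].
    by rewrite -gg' (negbTE gI) (negbTE gJ) in g'h'.
  case: eqP => [hh' | _]; last by rewrite andbF.
  by rewrite -hh' (negbTE hP) (negbTE hQ) !andbF in g'h'.
have := independent_leq wc iS1 mS.
have dS1 : [disjoint S :\: S0 & S1].
  rewrite disjoint_subset; apply/subsetP => -[g h] /outS[gI gJ _ _].
  by rewrite !inE /= (negbTE gI) (negbTE gJ).
move: dS1; rewrite -leq_card_setU => /eqP->; rewrite cXU.
have := cardsID S0 S; rewrite (setIidPr sS0) cXU.
(* The inequality left amounts to [(#|I| - #|J|) * (#|P| - #|Q|) <= 0] over the integers, but both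
   factors are positive. *)
nia.
Qed.

Lemma product_disjoint_balanced :
  well_covered eP -> disjoint_balanced eG \/ disjoint_balanced eH.
Proof.
move=> wc.
have sR (V : finType) (e : rel V) : symmetric [rel A B | [&& maximal_independent e A,
    maximal_independent e B & [disjoint A & B]]].
  by move=> A B /=; rewrite disjoint_sym andbCA.
have [balG | [I [J [/and3P[mI mJ dIJ] ltJI]]]] := unequal_cards_or (sR T eG).
  by left=> A B mA mB dAB; apply: balG; apply/and3P.
have [balH | [P [Q [/and3P[mP mQ dPQ] ltQP]]]] := unequal_cards_or (sR U eH).
  by right=> A B mA mB dAB; apply: balH; apply/and3P.
by case: (product_disjoint_pairs wc mI mJ dIJ ltJI mP mQ dPQ ltQP).
Qed.

End Product.

(** Swapping coordinates is a graph isomorphism. This lets [private_neighbors_of_product], which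
    treats the second factor, serve the first one too. *)
Lemma well_covered_productC (T U : finType) (eG : rel T) (eH : rel U) :
  symmetric eG -> irreflexive eG -> symmetric eH -> irreflexive eH ->
  well_covered (cartesian_product eG eH) ->
  well_covered (cartesian_product eH eG).
Proof.
move=> sG iG sH iH wc.
pose sw (x : U * T) := (x.2, x.1).
have sw_inj : injective sw by move=> [a b] [c d] [-> ->].
have swE x y : cartesian_product eG eH (sw x) (sw y) = cartesian_product eH eG x y.
  by rewrite /cartesian_product /= orbC andbC [X in _ || X]andbC.
have mx A : maximal_independent (cartesian_product eH eG) A ->
    maximal_independent (cartesian_product eG eH) (sw @: A).
  move/(maximal_independentP (cartesian_product_sym sH sG)
          (cartesian_product_irr iH iG)) => [/independentP iA domA].
  apply/(maximal_independentP (cartesian_product_sym sG sH)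
          (cartesian_product_irr iG iH)); split.
    by apply/independentP => _ _ /imsetP[x xA ->] /imsetP[y yA ->]; rewrite swE; apply: iA.
  move=> [g h]; rewrite -[(g, h)]/(sw (h, g)) (mem_imset _ _ sw_inj) => /domA[y yA exy].
  by exists (sw y); rewrite ?swE // mem_imset.
move=> A B /mx mA /mx mB.
by rewrite -(card_imset (mem A) sw_inj) -(card_imset (mem B) sw_inj) (wc _ _ mA mB).
Qed.

Theorem theorem2 (T U : finType) (eG : rel T) (eH : rel U)
    (eG_sym : symmetric eG) (eG_irr : irreflexive eG)
    (eH_sym : symmetric eH) (eH_irr : irreflexive eH) :
  well_covered (cartesian_product eG eH) ->
  well_covered eG \/ well_covered eH.
Proof.
move=> wc.
have [wcG | [I [J [mI mJ ltJI]]]] := well_covered_or eG; first by left.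
have [wcH | [P [Q [mP mQ ltQP]]]] := well_covered_or eH; first by right.
(* The unequal pair in each factor yields private neighbours in the other. *)
have pnH := private_neighbors_of_product eG_sym eG_irr eH_sym eH_irr wc mI mJ ltJI.
have wc' := well_covered_productC eG_sym eG_irr eH_sym eH_irr wc.
have pnG := private_neighbors_of_product eH_sym eH_irr eG_sym eG_irr wc' mP mQ ltQP.
have [bal | bal] := product_disjoint_balanced eG_sym eG_irr eH_sym eH_irr wc.
  by left; apply: well_covered_of_disjoint.
by right; apply: well_covered_of_disjoint.
Qed.
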